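(* For every $n\ge1$ and every permutation $\pi\in\mathfrak S_n$, $$\Phi_{\mathrm{FZ}}^{-1}\circ\xi\circ\Phi_{\mathrm{FZ}}(\pi)=\theta(\pi),$$ $$\Phi_{\mathrm{YZL}}(\pi)=\Phi_{\mathrm{FZ}}\circ\theta(\pi^{\mathrm{rci}})=\Phi_{\mathrm{FZ}}\circ\varkappa(\pi).$$
   Context: $[n]=\{1,\dots,n\}$; $\mathfrak S_n$ is the set of permutations of $[n]$, written $\pi=\pi(1)\cdots\pi(n)$. $\chi$ of a statement is $1$ if it is true and $0$ otherwise. Maps on permutations. $\pi^{\mathrm{rci}}$ is obtained from $\pi$ by taking the inverse, then the complement ($\sigma(i)\mapsto n+1-\sigma(i)$), then the reverse ($\sigma(1)\cdots\sigma(n)\mapsto\sigma(n)\cdots\sigma(1)$); i.e. $\pi^{\mathrm{rci}}(i)=n+1-\pi^{-1}(n+1-i)$. $\theta(\pi)=\theta_1\cdots\theta_n$ with $\theta_n=n+1-\pi(n)$ and $\theta_i=n+1-\pi(n-i)$ for $1\le i<n$. The Kreweras complement is $\varkappa(\pi)=\pi^{-1}(2)\,\pi^{-1}(3)\cdots\pi^{-1}(n)\,\pi^{-1}(1)$ in one-line notation. Histories. A 2-Motzkin path of length $n$ is a word $w=w_1\cdots w_n$ over $\{\mathrm N,\mathrm S,\mathrm E,\mathrm{dE}\}$ such that, with $h_i:=\#\{j<i: w_j=\mathrm N\}-\#\{j<i: w_j=\mathrm S\}$ for $1\le i\le n+1$, one has $h_i\ge 0$ for all $i$ and $h_{n+1}=0$.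 An sr-Laguerre history of length $n$ is a triple $W=(w,h,c)$ where $w$ is a 2-Motzkin path of length $n$, $h=h_1\cdots h_n$ is its height sequence, and $c=c_1\cdots c_n$ is a sequence of integers with $0\le c_i\le h_i$ if $w_i\in\{\mathrm N,\mathrm E\}$ and $1\le c_i\le h_i$ if $w_i\in\{\mathrm S,\mathrm{dE}\}$. $\mathfrak L_n$ is the set of all of these; $\mathrm{cs}(W):=\max\{i\in[n]: c_i=0\}$. The map $\xi:\mathfrak L_n\to\mathfrak L_n$ is the unique involution such that for $W=(w,h,c)$ with $\mathrm{cs}(W)=m$ and $\xi(W)=(v,g,b)$: (1) $\mathrm{cs}(\xi(W))=n+1-m$; (2) for $j\ne n+1-m$, $v_j\in\{\mathrm N,\mathrm E\}$ iff $w_{n+1-j}\in\{\mathrm S,\mathrm{dE}\}$; (3) $g_j=h_{n+1-j}+1$ if $j>n+1-m$ and $v_j\in\{\mathrm S,\mathrm{dE}\}$, $g_j=h_{n+1-j}-1$ if $j<n+1-m$ and $v_j\in\{\mathrm N,\mathrm E\}$, and $g_j=h_{n+1-j}$ otherwise; (4) $b_j=g_j-h_{n+1-j}+c_{n+1-j}$ for all $j\in[n]$. The bijection $\Phi_{\mathrm{FZ}}:\mathfrak S_n\to\mathfrak L_n$. Let $\mathrm{Ep}(\pi)=\{i\in[n]:\pi(i)>i\}$; side numbers: if $i\in\mathrm{Ep}(\pi)$, $s_i=\#\{j\in\mathrm{Ep}(\pi): j<i,\ \pi(j)>\pi(i)\}$; if $i\notin\mathrm{Ep}(\pi)$, $s_i=\#\{j\notin\mathrm{Ep}(\pi):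 j>i,\ \pi(j)<\pi(i)\}$. Then $\Phi_{\mathrm{FZ}}(\pi)=(w,h,c)$ where $w_i=\mathrm N$ if $\pi^{-1}(i)>i<\pi(i)$; $w_i=\mathrm S$ if $\pi^{-1}(i)<i>\pi(i)$; $w_i=\mathrm E$ if $\pi^{-1}(i)\ge i\ge\pi(i)$; $w_i=\mathrm{dE}$ if $\pi^{-1}(i)<i<\pi(i)$; $h$ is the height sequence of $w$; and $c_i=s_{\pi^{-1}(i)}+\chi(w_i\in\{\mathrm S,\mathrm{dE}\})$. The bijection $\Phi_{\mathrm{YZL}}:\mathfrak S_n\to\mathfrak L_n$. Let $\mathrm{pone}(\pi)=\pi^{-1}(1)$. Define $\Phi_{\mathrm{YZL}}(\pi)=(w,h,c)$ as follows. For $i\in[n-1]$ with $i\ne\mathrm{pone}(\pi)$: $w_i=\mathrm N$ if $i<\pi(i)$ and $i+1\le\pi^{-1}(i+1)$; $w_i=\mathrm S$ if $i\ge\pi(i)$ and $i+1>\pi^{-1}(i+1)$; $w_i=\mathrm E$ if $i<\pi(i)$ and $i+1>\pi^{-1}(i+1)$; $w_i=\mathrm{dE}$ if $i\ge\pi(i)$ and $i+1\le\pi^{-1}(i+1)$. If $i=\mathrm{pone}(\pi)\le n-1$: $w_i=\mathrm N$ if $i+1\le\pi^{-1}(i+1)$ and $w_i=\mathrm E$ if $i+1>\pi^{-1}(i+1)$. Finally $w_n=\mathrm S$ if $\mathrm{pone}(\pi)\ne n$ and $w_n=\mathrm E$ if $\mathrm{pone}(\pi)=n$. The sequence $h$ is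 the height sequence of $w$, and $c_i=\mathrm{vnest}_i(\pi)+\chi(w_i\in\{\mathrm S,\mathrm{dE}\})$ for $i\in[n]$, where $\mathrm{nest}_i(\pi)=\#\{j: j<i<\pi(i)<\pi(j)\text{ or }\pi(j)<\pi(i)\le i<j\}$ and $\mathrm{vnest}_i(\pi)=\mathrm{nest}_i(\pi)-1$ if $\pi(i)\le i$ and $i<\mathrm{pone}(\pi)$; $\mathrm{vnest}_i(\pi)=\mathrm{nest}_i(\pi)+1$ if $\pi(i)>i$ and $i>\mathrm{pone}(\pi)$; $\mathrm{vnest}_i(\pi)=\mathrm{nest}_i(\pi)$ otherwise. *)

(* Defs.v *)
From HB Require Import structures.
From mathcomp Require Import all_boot all_order all_fingroup all_algebra.
From mathcomp Require Import zify.

Set Implicit Arguments.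
Unset Strict Implicit.
Unset Printing Implicit Defensive.

Import Order.TTheory GRing.Theory Num.Theory.

Local Open Scope ring_scope.

(* [n] is represented by 'I_n = {0, ..., n-1}: the integer i of [n] is the    *)
(* ordinal with value i - 1, and n + 1 - i becomes rev_ord.  Comparisons      *)
(* between positions and values are unaffected by the shift.                  *)

Inductive step := stepN | stepS | stepE | stepdE.

Definition step_code (s : step) : bool * bool :=
  match s with
  | stepN => (true, true) | stepS => (false, false)
  | stepE => (true, false) | stepdE => (false, true)
  end.

Definition step_decode (b : bool * bool) : step :=
  match b with
  | (true, true) => stepN | (false, false) => stepS
  | (true, false) => stepE | (false, true) => stepdE
  end.

Lemma step_codeK : cancel step_code step_decode. Proof. by case. Qed.

HB.instance Definition _ := Finite.copy step (can_type step_codeK).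

Definition inNE (s : step) : bool := (s == stepN) || (s == stepE).
Definition inSdE (s : step) : bool := (s == stepS) || (s == stepdE).

(* With 0-based positions, height w k is h_(k+1); it is meaningful for        *)
(* 0 <= k <= n.                                                               *)
Definition height n (w : {ffun 'I_n -> step}) (k : nat) : int :=
  #|[set j : 'I_n | (j < k)%N & w j == stepN]|%:Z
  - #|[set j : 'I_n | (j < k)%N & w j == stepS]|%:Z.

Definition motzkin2 n (w : {ffun 'I_n -> step}) : bool :=
  [forall k : 'I_n.+1, 0 <= height w k] && (height w n == 0).

Definition height_seq n (w : {ffun 'I_n -> step}) : {ffun 'I_n -> int} :=
  [ffun i : 'I_n => height w i].

Definition triple n : Type :=
  ({ffun 'I_n -> step} * {ffun 'I_n -> int} * {ffun 'I_n -> int})%type.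

Definition is_laguerre n (W : triple n) : bool :=
  let: (w, h, c) := W in
  [&& motzkin2 w, h == height_seq w &
      [forall i, if inNE (w i) then 0 <= c i <= h i else 1 <= c i <= h i]].

Record laguerre n := Laguerre { lagval :> triple n; _ : is_laguerre lagval }.

HB.instance Definition _ n := [isSub for @lagval n].
HB.instance Definition _ n := [Choice of laguerre n by <:].

Definition lword n (W : laguerre n) : {ffun 'I_n -> step} := (val W).1.1.
Definition lheight n (W : laguerre n) : {ffun 'I_n -> int} := (val W).1.2.
Definition lcol n (W : laguerre n) : {ffun 'I_n -> int} := (val W).2.

(* 1-based, as in [n]; the index set of the maximum is nonempty as soon as    *)
(* n >= 1, because c_1 = 0.                                                   *)
Definition cs n (W : laguerre n) : nat :=
  \max_(i < n | lcol W i == 0) i.+1.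

Definition is_xi n (f : laguerre n -> laguerre n) : Prop :=
  involutive f /\
  forall W : laguerre n,
    let w := lword W in let h := lheight W in let c := lcol W in
    let v := lword (f W) in let g := lheight (f W) in let b := lcol (f W) in
    let m := cs W in let m' := (n.+1 - m)%N in
    [/\ cs (f W) = m',
        forall j : 'I_n, j.+1 <> m' -> inNE (v j) = inSdE (w (rev_ord j)),
        forall j : 'I_n,
          g j = if (m' < j.+1)%N && inSdE (v j) then h (rev_ord j) + 1
                else if (j.+1 < m')%N && inNE (v j) then h (rev_ord j) - 1
                else h (rev_ord j)
      & forall j : 'I_n, b j = g j - h (rev_ord j) + c (rev_ord j)].

Definition delta (s : step) : int := (s == stepN)%:Z - (s == stepS)%:Z.

Lemma inSdEE s : inSdE s = ~~ inNE s. Proof. by case: s. Qed.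

Lemma card_sumz n (P : pred 'I_n) :
  #|[set j | P j]|%:Z = \sum_j (P j)%:Z.
Proof.
rewrite cardsE -sum1_card big_mkcond /= (big_morph Posz PoszD (erefl _)).
by apply: eq_bigr => j _; rewrite -topredE /=; case: (P j).
Qed.

Lemma heightE n (w : {ffun 'I_n -> step}) k (A B : pred 'I_n) :
    (forall j, delta (w j) = (A j)%:Z - (B j)%:Z) ->
  height w k = \sum_(j < n) (((j < k)%N && A j)%:Z - ((j < k)%N && B j)%:Z).
Proof.
move=> dE; rewrite /height !card_sumz -sumrB; apply: eq_bigr => j _.
by have := dE j; rewrite /delta; case: (j < k)%N; rewrite /= ?subr0.
Qed.

Lemma height0 n (w : {ffun 'I_n -> step}) : height w 0 = 0.
Proof.
by rewrite /height !card_sumz !big1.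
Qed.

Lemma heightS n (w : {ffun 'I_n -> step}) (j : 'I_n) :
  height w j.+1 = height w j + delta (w j).
Proof.
have E k := @heightE n w k [pred j | w j == stepN] [pred j | w j == stepS]
              (fun=> erefl).
rewrite !E (bigD1 j) //= [X in _ = X + _](bigD1 j) //= ltnSn ltnn /= subr0 add0r.
rewrite addrC; congr (_ + _); apply: eq_bigr => i nij.
by rewrite ltnS leq_eqVlt -val_eqE /= in nij *; rewrite (negPf nij).
Qed.

Lemma heightP n (w : {ffun 'I_n -> step}) (G : nat -> int) :
    G 0%N = 0 -> (forall j : 'I_n, G j.+1 = G j + delta (w j)) ->
  forall k, (k <= n)%N -> height w k = G k.
Proof.
move=> G0 GS; elim=> [|k IH] lkn; first by rewrite height0.
by have := heightS w (Ordinal lkn); rewrite /= => ->; rewrite IH 1?ltnW // (GS (Ordinal lkn)).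
Qed.

Lemma laguerreP n (w : {ffun 'I_n -> step}) (c : {ffun 'I_n -> int}) :
    (forall k, (k <= n)%N -> 0 <= height w k) -> height w n = 0 ->
    (forall i, (~~ inNE (w i))%:Z <= c i <= height w i) ->
  is_laguerre (w, height_seq w, c).
Proof.
move=> h0 hn cP; rewrite /is_laguerre /motzkin2 hn !eqxx andbT /=.
apply/andP; split; first by apply/forallP => k; apply: h0; rewrite -ltnS.
by apply/forallP=> i; have := cP i; rewrite ffunE; case: (inNE _).
Qed.

Lemma lagE n (W : laguerre n) : val W = (lword W, lheight W, lcol W).
Proof. by rewrite /lword /lheight /lcol; case: (val W) => -[]. Qed.

Lemma lagP n (W : laguerre n) :
  [/\ forall k, (k <= n)%N -> 0 <= height (lword W) k,
      height (lword W) n = 0,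
      forall i, lheight W i = height (lword W) i &
      forall i, (~~ inNE (lword W i))%:Z <= lcol W i <= height (lword W) i].
Proof.
have := valP W; rewrite lagE => /and3P[/andP[/forallP h0 /eqP hn] /eqP hE /forallP cP].
have hi i : lheight W i = height (lword W) i by rewrite hE ffunE.
split=> // [k lkn|i]; first exact: (h0 (Ordinal (lkn : k < n.+1)%N)).
by have := cP i; rewrite hi; case: (inNE _).
Qed.

Lemma csP n (W : laguerre n.+1) :
  exists m : 'I_n.+1, [/\ cs W = m.+1, lcol W m = 0 &
    forall i : 'I_n.+1, (m < i)%N -> lcol W i != 0].
Proof.
have c0 : lcol W ord0 == 0.
  case: (lagP W) => _ _ _ /(_ ord0); rewrite height0.
  by case: (inNE _) => /=; lia.
rewrite /cs (bigop.bigmax_eq_arg ord0) //; case: arg_maxnP => // m /eqP cm mP.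
exists m; split=> // i lmi; apply/negP => /mP; lia.
Qed.

Lemma csE n (W : laguerre n) (m : 'I_n) :
  lcol W m = 0 -> (forall i : 'I_n, (m < i)%N -> lcol W i != 0) -> cs W = m.+1.
Proof.
move=> cm mP; apply/eqP; rewrite eqn_leq; apply/andP; split.
  by apply/bigop.bigmax_leqP => i ci; rewrite ltnS leqNgt; apply/negP => /mP; rewrite ci.
by rewrite /cs (bigop.bigmax_sup m) // cm.
Qed.

(* A history is determined by the heights and by which letters are in {N, E}. *)
Lemma lag_inj n (W V : laguerre n) :
    (forall i, inNE (lword W i) = inNE (lword V i)) ->
    (forall i, lheight W i = lheight V i) ->
    (forall i, lcol W i = lcol V i) -> W = V.
Proof.
move=> eU eh ec; apply: val_inj; rewrite !lagE.
have -> : lcol W = lcol V by apply/ffunP.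
have -> : lheight W = lheight V by apply/ffunP.
suff -> : lword W = lword V by [].
apply/ffunP => i; have := eU i.
case: (lagP W) (lagP V) => _ Wn Wh _ [_ Vn Vh _].
have := heightS (lword W) i; have := heightS (lword V) i.
have <- : height (lword W) i = height (lword V) i by rewrite -Wh -Vh eh.
suff <- : height (lword W) i.+1 = height (lword V) i.+1.
  by move=> ->; case: (lword W i); case: (lword V i) => //; rewrite /delta /=; lia.
have := ltn_ord i; rewrite leq_eqVlt => /predU1P[->|lin]; first by rewrite Wn Vn.
by have := eh (Ordinal lin); rewrite Wh Vh.
Qed.

Lemma inNE_cs n (W : laguerre n.+1) (i : 'I_n.+1) :
  i.+1 = cs W -> inNE (lword W i).
Proof.
have [m [-> cm _]] := csP W; case=> /val_inj ->; case: (lagP W) => _ _ _ /(_ m).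
by rewrite cm; case: (inNE _) => //=; lia.
Qed.

Section XiConstruction.
Variables (n : nat) (W : laguerre n.+1).
Let w := lword W.
Let c := lcol W.
Let m := cs W.

Definition xi_up (j : 'I_n.+1) : bool :=
  ((rev_ord j).+1 == m) || inSdE (w (rev_ord j)).

Definition xi_shift (i : 'I_n.+1) : int :=
  ((i.+1 < m)%N && inNE (w i))%:Z - ((m < i.+1)%N && inSdE (w i))%:Z.

Definition xi_height (k : nat) : int :=
  if insub k is Some j
  then height w (rev_ord j : 'I_n.+1) + xi_shift (rev_ord j) else 0.

Definition xi_word : {ffun 'I_n.+1 -> step} :=
  [ffun j : 'I_n.+1 =>
    if xi_up j then if xi_height j.+1 == xi_height j then stepE else stepN
    else if xi_height j.+1 == xi_height j then stepdE else stepS].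

Definition xi_col : {ffun 'I_n.+1 -> int} :=
  [ffun j => xi_shift (rev_ord j) + c (rev_ord j)].

Lemma xi_heightE (j : 'I_n.+1) :
  xi_height j = height w (rev_ord j) + xi_shift (rev_ord j).
Proof. by rewrite /xi_height valK. Qed.

Lemma xi_height_step (j : 'I_n.+1) :
  if xi_up j then (xi_height j.+1 == xi_height j) || (xi_height j.+1 == xi_height j + 1)
  else (xi_height j.+1 == xi_height j) || (xi_height j.+1 == xi_height j - 1).
Proof.
have [m0 [mE cm0 cm]] := csP W; case: (lagP W) => _ _ _ cP.
rewrite xi_heightE /xi_up /xi_shift !inSdEE.
set i := rev_ord j; have iE : (i + j = n)%N by rewrite /= ; have := ltn_ord j; lia.
have up_m : (i.+1 == m) -> inNE (w i).
  by move/eqP/inNE_cs.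
case: (ltnP j.+1 n.+1) => [ljn|lnj].
  have -> : xi_height j.+1 = xi_height (Ordinal ljn) by [].
  rewrite xi_heightE /xi_shift; set i' := rev_ord _.
  have i'E : (i = i'.+1 :> nat)%N by rewrite /=; have := ltn_ord j; lia.
  rewrite i'E heightS -/w inSdEE -i'E.
  have up_m' : (i'.+1 == m) -> inNE (w i').
    by move/eqP/inNE_cs.
  move: up_m up_m'; rewrite -i'E.
  by case: (ltngtP i m) => im; case: (ltngtP i.+1 m) => im'; try lia;
     rewrite ?eqxx /=; case: (w i) => up; case: (w i') => up' /=;
     try (by have := up isT); try (by have := up' isT); rewrite /delta /=; lia.
have i0 : i = 0%N :> nat by lia.
have -> : xi_height j.+1 = 0 by rewrite /xi_height insubF //; lia.
have upi : inNE (w i).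
  by have := cP i; rewrite i0 height0 -/w; case: (inNE _) => //=; lia.
have m_gt0 : (0 < m)%N by rewrite /m mE.
rewrite upi i0 height0 /= andbT andbF.
by case: (ltngtP 1 m) m_gt0 => //=; lia.
Qed.

Lemma xi_deltaE (j : 'I_n.+1) :
  xi_height j.+1 = xi_height j + delta (xi_word j).
Proof.
have := xi_height_step j; rewrite ffunE /delta; case: (xi_up j);
by case: eqP => /= [->|_ /eqP ->]; lia.
Qed.

Lemma xi_upE (j : 'I_n.+1) : inNE (xi_word j) = xi_up j.
Proof. by rewrite ffunE; case: (xi_up j); case: ifP. Qed.

Lemma xi_height0 : xi_height 0 = 0.
Proof.
have [m0 [mE cm0 cm]] := csP W; case: (lagP W) => h0 hn _ cP.
rewrite (xi_heightE ord0) /xi_shift; set i := rev_ord _.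
have iE : i = n :> nat by rewrite /= subn1.
have i_max : (m <= i.+1)%N by rewrite /m mE iE ltn_ord.
have := heightS w i; rewrite -/w iE [height _ n.+1]hn.
have := cP i; rewrite -/w -/c iE.
have := h0 n (leqnSn n); rewrite -/w.
have : (m < i.+1)%N -> c i != 0.
  by rewrite /m mE ltnS => lmi; apply: cm.
have up_m := @inNE_cs _ W i; rewrite iE in i_max up_m *.
rewrite [(n.+1 < m)%N]ltnNge i_max /=; case: ltnP => /= lim nc0.
  by have := nc0 isT; case: (w i); rewrite /delta /=; lia.
have {}up_m : inNE (w i) by apply: up_m; apply/eqP; rewrite eqn_leq lim i_max.
by clear nc0; move: up_m; case: (w i); rewrite /delta //=; lia.
Qed.

Lemma xi_heightP k : (k <= n.+1)%N -> height xi_word k = xi_height k.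
Proof. by apply: heightP; [exact: xi_height0 | exact: xi_deltaE]. Qed.

Lemma xi_colP (j : 'I_n.+1) :
  (~~ inNE (xi_word j))%:Z <= xi_col j <= height xi_word j.
Proof.
have [m0 [mE cm0 cm]] := csP W; case: (lagP W) => _ _ _ cP.
rewrite xi_upE xi_heightP 1?ltnW // xi_heightE ffunE /xi_up /xi_shift.
set i := rev_ord j; rewrite inSdEE; have := cP i; rewrite -/w -/c.
have c0 : (m < i.+1)%N -> c i != 0 by rewrite /m mE ltnS => /cm.
case: ltngtP c0 => //= im c0; try have := c0 isT; case: (inNE (w i)) => /=; lia.
Qed.

Lemma xi_laguerre : is_laguerre (xi_word, height_seq xi_word, xi_col).
Proof.
apply: laguerreP xi_colP => [k|]; last first.
  by rewrite xi_heightP // /xi_height insubF //; lia.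
rewrite leq_eqVlt => /predU1P[->|lkn].
  by rewrite xi_heightP // /xi_height insubF //; lia.
by have := xi_colP (Ordinal lkn) => /=; case: (~~ _) => /=; lia.
Qed.

Definition xi_fun : laguerre n.+1 := Laguerre xi_laguerre.

Lemma xi_fun_cs : cs xi_fun = (n.+2 - m)%N.
Proof.
have [m0 [mE cm0 cm]] := csP W; case: (lagP W) => _ _ _ cP.
have -> : (n.+2 - m = (rev_ord m0).+1)%N.
  by rewrite /m mE /=; have := ltn_ord m0; lia.
apply: csE => [|i]; rewrite /lcol /= ffunE.
  by rewrite rev_ordK /c cm0 /xi_shift /m mE ltnn.
move=> lmi; rewrite /xi_shift /m mE inSdEE.
have li : ((rev_ord i).+1 < m0.+1)%N by rewrite /= in lmi *; have := ltn_ord m0; have := ltn_ord i; lia.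
rewrite li ltnNge ltnW //=; have := cP (rev_ord i); rewrite -/w -/c.
by case: (inNE _) => /=; lia.
Qed.

Lemma xi_fun_up (j : 'I_n.+1) : inNE (lword xi_fun j) = xi_up j.
Proof. exact: xi_upE. Qed.

Lemma xi_fun_height (j : 'I_n.+1) :
  lheight xi_fun j = lheight W (rev_ord j) + xi_shift (rev_ord j).
Proof.
case: (lagP W) => _ _ -> _.
by rewrite /lheight /= ffunE xi_heightP 1?ltnW // xi_heightE.
Qed.

Lemma xi_fun_col (j : 'I_n.+1) :
  lcol xi_fun j = xi_shift (rev_ord j) + c (rev_ord j).
Proof. by rewrite /lcol /= ffunE. Qed.

End XiConstruction.

Lemma xi_fun_is_xi n : is_xi (@xi_fun n).
Proof.
split=> W; last first.
  have [m0 [mE _ _]] := csP W.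
  split=> [|j jm|j|j]; first exact: xi_fun_cs.
  - rewrite xi_fun_up /xi_up orb_idl // => /eqP; have := ltn_ord j.
    by rewrite mE in jm * => /=; lia.
  - rewrite xi_fun_height inSdEE !xi_fun_up /xi_up /xi_shift !inSdEE.
    have -> : ((rev_ord j).+1 < cs W)%N = (n.+2 - cs W < j.+1)%N.
      by have := ltn_ord j; have := ltn_ord m0; rewrite mE /=; lia.
    have -> : (cs W < (rev_ord j).+1)%N = (j.+1 < n.+2 - cs W)%N.
      by have := ltn_ord j; have := ltn_ord m0; rewrite mE /=; lia.
    have -> : ((rev_ord j).+1 == cs W) = (n.+2 - cs W == j.+1)%N.
      by have := ltn_ord j; have := ltn_ord m0; rewrite mE /=; lia.
    by case: ltngtP => /= _; case: (inNE (lword W (rev_ord j))) => /=; lia.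
  - by rewrite xi_fun_height xi_fun_col; lia.
have [m0 [mE _ _]] := csP W.
have up_m := @inNE_cs _ W.
have sh j : xi_shift (xi_fun W) (rev_ord j) + xi_shift W j = 0.
  rewrite /xi_shift !inSdEE xi_fun_cs xi_fun_up /xi_up rev_ordK inSdEE.
  have -> : ((rev_ord j).+1 < n.+2 - cs W)%N = (cs W < j.+1)%N.
    by have := ltn_ord j; have := ltn_ord m0; rewrite mE /=; lia.
  have -> : (n.+2 - cs W < (rev_ord j).+1)%N = (j.+1 < cs W)%N.
    by have := ltn_ord j; have := ltn_ord m0; rewrite mE /=; lia.
  by case: ltngtP => /= _; case: (inNE (lword W j)) => /=; lia.
apply: lag_inj => j.
- rewrite xi_fun_up /xi_up inSdEE xi_fun_up xi_fun_cs /xi_up rev_ordK inSdEE.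
  have -> : ((rev_ord j).+1 == n.+2 - cs W)%N = (j.+1 == cs W)%N.
    by have := ltn_ord j; have := ltn_ord m0; rewrite mE /=; lia.
  by case: eqP => [/up_m ->|_] //=; rewrite negbK.
- by rewrite !xi_fun_height rev_ordK; have := sh j; lia.
- by rewrite !xi_fun_col rev_ordK; have := sh j; lia.
Qed.

Lemma is_xi_uniq n (f1 f2 : laguerre n.+1 -> laguerre n.+1) :
  is_xi f1 -> is_xi f2 -> f1 =1 f2.
Proof.
move=> [_ P1] [_ P2] W.
have [cs1 u1 h1 c1] := P1 W; have [cs2 u2 h2 c2] := P2 W.
have eU j : inNE (lword (f1 W) j) = inNE (lword (f2 W) j).
  have [jm|jm] := eqVneq j.+1 (n.+2 - cs W)%N; last first.
    by move/eqP: jm => jm; rewrite (u1 j jm) (u2 j jm).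
  by rewrite !inNE_cs ?cs1 ?cs2.
have eh j : lheight (f1 W) j = lheight (f2 W) j.
  by rewrite h1 h2 !inSdEE eU.
by apply: lag_inj => // j; rewrite c1 c2 eh.
Qed.

Theorem xi_exists_unique n :
  {f : laguerre n.+1 -> laguerre n.+1 | is_xi f & forall f', is_xi f' -> f' =1 f}.
Proof.
exists (@xi_fun n); first exact: xi_fun_is_xi.
by move=> f' Pf'; apply: is_xi_uniq Pf' (@xi_fun_is_xi n).
Qed.

Definition xi n : laguerre n.+1 -> laguerre n.+1 := s2val (xi_exists_unique n).

Section Permutations.
Variable n : nat.
Implicit Type p : 'S_n.

Lemma rci_inj p : injective (fun i => rev_ord ((p^-1)%g (rev_ord i))).
Proof. by move=> i j /rev_ord_inj/perm_inj/rev_ord_inj. Qed.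

Definition rci p : 'S_n := perm (@rci_inj p).

(* theta_n is the first case; for the 1-based position i < n, n - i is the    *)
(* reversal of i + 1.                                                         *)
Definition theta_fun p (i : 'I_n) : 'I_n :=
  if i.+1 == n then rev_ord (p i) else rev_ord (p (rev_ord (ordS i))).

Lemma theta_inj p : injective (theta_fun p).
Proof.
have E i : theta_fun p i = rev_ord (p (rev_ord (ordS i))).
  rewrite /theta_fun; case: eqP => // ein; congr (rev_ord (p _)).
  apply: val_inj; rewrite /= [X in (X %% _)%N]ein modnn.
  by have := ltn_ord i; lia.
by move=> i j; rewrite !E => /rev_ord_inj/perm_inj/rev_ord_inj/ordS_inj.
Qed.

Definition theta p : 'S_n := perm (@theta_inj p).

(* ordS is the cyclic successor i |-> i + 1, with n |-> 1.                    *)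
Lemma kreweras_inj p : injective (fun i => (p^-1)%g (ordS i)).
Proof. by move=> i j /perm_inj/ordS_inj. Qed.

Definition kreweras p : 'S_n := perm (@kreweras_inj p).

Definition Ep p : {set 'I_n} := [set i : 'I_n | (i < p i)%N].

Definition side p (i : 'I_n) : nat :=
  if i \in Ep p then #|[set j in Ep p | (j < i)%N & (p i < p j)%N]|
  else #|[set j in ~: Ep p | (i < j)%N & (p j < p i)%N]|.

(* The four cases are exhaustive.                                             *)
Definition FZ_word p : {ffun 'I_n -> step} :=
  [ffun i : 'I_n =>
    let pi_inv := (p^-1)%g i in
    if (i < pi_inv)%N && (i < p i)%N then stepN
    else if (pi_inv < i)%N && (p i < i)%N then stepS
    else if (i <= pi_inv)%N && (p i <= i)%N then stepE
    else (* pi_inv < i < p i *) stepdE].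

Definition FZ_col p : {ffun 'I_n -> int} :=
  [ffun i => (side p ((p^-1)%g i))%:Z + (inSdE (FZ_word p i))%:Z].

Lemma fix_permV p j : (p j = j :> nat) <-> ((p^-1)%g j = j :> nat).
Proof.
by split=> /val_inj E; congr val; [rewrite -{1}E permK | rewrite -{1}E permKV].
Qed.

Lemma FZ_deltaE p j :
  delta (FZ_word p j) = (j < p j)%N%:Z - ((p^-1)%g j < j)%N%:Z.
Proof.
have E := fix_permV p j.
rewrite ffunE /=; case: (ltngtP j (p j)) => h1; case: (ltngtP j ((p^-1)%g j)) => h2;
 rewrite /delta //=; lia.
Qed.

Lemma FZ_heightE p k :
  height (FZ_word p) k = #|[set l : 'I_n | (l < k <= p l)%N]|%:Z.
Proof.
rewrite (heightE _ (FZ_deltaE p)) sumrB.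
rewrite [X in _ - X](reindex_inj (@perm_inj _ p)) /= -sumrB card_sumz.
apply: eq_bigr => l _; rewrite permK.
by case: (ltnP l k); case: (ltnP (p l) k); case: (ltnP l (p l)) => //=; lia.
Qed.

Lemma card_cross p k :
  #|[set l : 'I_n | (l < k <= p l)%N]|%:Z = #|[set l : 'I_n | (p l < k <= l)%N]|%:Z.
Proof.
apply/eqP; rewrite -subr_eq0 !card_sumz -sumrB.
rewrite (eq_bigr (fun l : 'I_n => (l < k)%N%:Z - (p l < k)%N%:Z)).
  by rewrite sumrB [X in X - _](reindex_inj (@perm_inj _ p)) subrr.
by move=> l _; case: (ltnP l k); case: (ltnP (p l) k).
Qed.

Lemma FZ_laguerre p :
  is_laguerre (FZ_word p, height_seq (FZ_word p), FZ_col p).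
Proof.
apply: laguerreP => [k _||i]; first by rewrite FZ_heightE.
  rewrite FZ_heightE; apply/eqP; rewrite eqz_nat cards_eq0 -subset0.
  by apply/subsetP=> l; rewrite inE; have := ltn_ord (p l); lia.
have up : inNE (FZ_word p i) = (i <= (p^-1)%g i)%N.
  have E := fix_permV p i.
  rewrite ffunE /=; case: (ltngtP i (p i)) => h1;
  case: (ltngtP i ((p^-1)%g i)) => h2 //=; lia.
rewrite [FZ_col p i]ffunE FZ_heightE inSdEE up /side inE permKV; set j := (p^-1)%g i.
have pj : p j = i by rewrite permKV.
rewrite -ltnNge; case: ltnP => lij /=.
  rewrite -PoszD !lez_nat addn1 /=; apply: proper_card; apply/properP; split.
    by apply/subsetP=> l; rewrite !inE; lia.
  by exists j; rewrite !inE ?pj ?lij ?ltnn ?andbF //=; lia.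
rewrite card_cross addr0 lez_nat /=.
by apply: subset_leq_card; apply/subsetP=> l; rewrite !inE; lia.
Qed.

Definition Phi_FZ p : laguerre n := Laguerre (FZ_laguerre p).

(* Some p for a preimage p of W, None if W has no preimage.                   *)
Definition Phi_FZ_inv (W : laguerre n) : option 'S_n :=
  [pick p | Phi_FZ p == W].

End Permutations.

Section YZL.
Variable n : nat.
Implicit Type p : 'S_n.+1.

Definition pone p : 'I_n.+1 := (p^-1)%g ord0.

Definition YZL_word p : {ffun 'I_n.+1 -> step} :=
  [ffun i : 'I_n.+1 =>
    let a := (i < p i)%N in
    let b := (ordS i <= (p^-1)%g (ordS i))%N in
    if i == ord_max then (if pone p == ord_max then stepE else stepS)
    else if i == pone p then (if b then stepN else stepE)
    else if a && b then stepN
    else if ~~ a && ~~ b then stepS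
    else if a && ~~ b then stepE
    else stepdE].

Definition nest p (i : 'I_n.+1) : nat :=
  #|[set j : 'I_n.+1 | [&& (j < i)%N, (i < p i)%N & (p i < p j)%N]
                    || [&& (p j < p i)%N, (p i <= i)%N & (i < j)%N]]|.

Definition vnest p (i : 'I_n.+1) : int :=
  if (p i <= i)%N && (i < pone p)%N then (nest p i)%:Z - 1
  else if (i < p i)%N && (pone p < i)%N then (nest p i)%:Z + 1
  else (nest p i)%:Z.

Definition YZL_col p : {ffun 'I_n.+1 -> int} :=
  [ffun i => vnest p i + (inSdE (YZL_word p i))%:Z].

Definition kreweras_inv p (i : 'I_n.+1) : 'I_n.+1 := ord_pred (p i).

Lemma pone0 p i : (i == pone p) = (p i == 0%N :> nat).
Proof. by rewrite /pone -[LHS](inj_eq (@perm_inj _ p)) permKV. Qed.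

Lemma kreweras_invE p i : kreweras_inv p i = (if i == pone p then n else (p i).-1) :> nat.
Proof.
rewrite pone0 /kreweras_inv /=; case: eqP => [->|/eqP pi0].
  by rewrite add0n modn_small.
by have := ltn_ord (p i) => ?; rewrite -subn1 -addnBAC ?lt0n // subn1 modnDr modn_small //; lia.
Qed.

Lemma YZL_deltaE p j :
  delta (YZL_word p j) = (j <= kreweras_inv p j)%N%:Z - (kreweras p j <= j)%N%:Z.
Proof.
rewrite [YZL_word p j]ffunE kreweras_invE /=.
have [->|jmax] := eqVneq j ord_max.
  have -> : (kreweras p ord_max <= @ord_max n)%N by rewrite -ltnS ltn_ord.
  rewrite [ord_max == pone p]eq_sym; case: eqP => [_|/eqP nm]; first by rewrite leqnn.
  have := ltn_ord (p ord_max); move: nm; rewrite eq_sym pone0 /delta /=.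
  by move=> ? ?; case: leqP => //=; lia.
have jn : (j.+1 < n.+1)%N.
  by have := ltn_ord j; rewrite -val_eqE /= in jmax *; lia.
rewrite [kreweras p j]permE; set q := (p^-1)%g (ordS j).
have -> : (j.+1 %% n.+1)%N = j.+1 by rewrite modn_small.
have [jp|jp] := eqVneq j (pone p).
  have -> : (j <= n)%N by rewrite -ltnS ltnW.
  by case: (ltnP j q).
rewrite pone0 in jp; have -> : (j <= (p j).-1)%N = (j < p j)%N by lia.
by case: (j < p j)%N; case: (ltnP j q).
Qed.

Lemma YZL_heightE p k :
  height (YZL_word p) k = #|[set l : 'I_n.+1 | (l < k <= kreweras_inv p l)%N]|%:Z.
Proof.
have kK l : kreweras p (kreweras_inv p l) = l by rewrite permE ord_predK permK.
have kr_inj : injective (kreweras_inv p) := can_inj kK.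
rewrite (heightE _ (YZL_deltaE p)) sumrB.
rewrite [X in _ - X](reindex_inj kr_inj) /= -sumrB card_sumz.
apply: eq_bigr => l _; rewrite kK.
by case: (ltnP l k); case: (ltnP (kreweras_inv p l) k); case: (leqP l (kreweras_inv p l)) => //=; lia.
Qed.

Lemma card_cross_kr p k :
  #|[set l : 'I_n.+1 | (l < k <= kreweras_inv p l)%N]|%:Z
  = #|[set l : 'I_n.+1 | (kreweras_inv p l < k <= l)%N]|%:Z.
Proof.
have kK l : kreweras p (kreweras_inv p l) = l by rewrite permE ord_predK permK.
have kr_inj : injective (kreweras_inv p) := can_inj kK.
have := card_cross (perm kr_inj) k.
have E l : perm kr_inj l = kreweras_inv p l by rewrite permE.
by congr (_%:Z = _%:Z); apply: eq_card => l; rewrite !inE E.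
Qed.

Lemma YZL_laguerre p :
  is_laguerre (YZL_word p, height_seq (YZL_word p), YZL_col p).
Proof.
apply: laguerreP => [k _||i]; first by rewrite YZL_heightE.
  rewrite YZL_heightE; apply/eqP; rewrite eqz_nat cards_eq0 -subset0.
  by apply/subsetP=> l; rewrite inE; have := ltn_ord (kreweras_inv p l); lia.
have up : inNE (YZL_word p i) = (i == pone p) || (i < p i)%N.
  rewrite ffunE /=; have [->|_] := eqVneq i ord_max.
    rewrite eq_sym; case: eqP => //= _.
    by apply/esym/negbTE; rewrite -leqNgt -ltnS ltn_ord.
  by case: eqP => //= _; case: (i < _)%N; case: (_ <= _)%N.
rewrite [YZL_col p i]ffunE YZL_heightE inSdEE up /vnest.
have q0 : p (pone p) = 0%N :> nat by apply/eqP; rewrite -pone0.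
have [ip|ip] := eqVneq i (pone p).
  have pi0 : p i = 0%N :> nat by rewrite ip.
  have -> : nest p i = 0%N.
    by apply/eqP; rewrite /nest cards_eq0; apply/eqP/setP=> l; rewrite !inE pi0; lia.
  by rewrite -ip pi0 ltnn.
rewrite orFb -leqNgt; case: (leqP (p i) i) => ilp; rewrite ?andFb ?andTb; last first.
  rewrite [(false : nat)%:Z]/= addr0; set A := [set l | _]; set b := (pone p < i)%N.
  have -> : (if b then (nest p i)%:Z + 1 else (nest p i)%:Z) = (nest p i + b)%N%:Z.
    by case: b; rewrite ?addn1 ?addn0 -?PoszD ?addn1.
  rewrite !lez_nat leq0n /= -lez_nat.
  set B := [set j : 'I_n.+1 | (j < i)%N && (p i < p j)%N].
  have -> : nest p i = #|B|.
    by apply: eq_card => j; rewrite !inE; lia.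
  have sBA : B \subset A.
    apply/subsetP=> j; rewrite !inE kreweras_invE pone0.
    by case: eqP; lia.
  rewrite lez_nat /b; case: ltnP => pi; last by rewrite addn0 subset_leq_card.
  rewrite addn1; apply: proper_card; apply/properP; split=> //.
  exists (pone p); rewrite !inE ?q0 ?ltn0 ?andbF // kreweras_invE eqxx pi /=.
  by rewrite -ltnS.
rewrite card_cross_kr; set A := [set l | _]; set b := (i < pone p)%N.
set B := [set j : 'I_n.+1 | (p j < p i)%N && (i < j)%N].
have -> : nest p i = #|B|.
  by apply: eq_card => j; rewrite !inE; lia.
have pA : pone p \notin A.
  by rewrite !inE kreweras_invE eqxx; have := ltn_ord i; lia.
have sBA : B :\ pone p \subset A.
  apply/subsetP=> j; rewrite !inE kreweras_invE => /and3P[/negPf-> ? ?]; lia.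
have iA : i \in A.
  by rewrite !inE kreweras_invE (negPf ip) leqnn; rewrite pone0 in ip; lia.
have iB : i \notin B :\ pone p by rewrite !inE !ltnn !andbF.
have bE : b = (pone p \in B).
  by rewrite inE q0 /b; rewrite pone0 in ip; rewrite lt0n ip.
have : (#|B :\ pone p| < #|A|)%N.
  by apply: proper_card; apply/properP; split=> //; exists i.
have := cardsD1 (pone p) B; rewrite -bE; case: b {bE} => /=; lia.
Qed.

Definition Phi_YZL p : laguerre n.+1 := Laguerre (YZL_laguerre p).

End YZL.

(* Main.v *)
(** A permutation is recovered from its Foata-Zeilberger history one value at a
    time: the letters give the exceedance positions and values, and once the
    positions of the smaller exceedance values are known, the side number of i
    is the rank of the position of i among the exceedance positions that are
    still free; the other values are treated in decreasing order.  It thus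
    suffices to identify the histories on both sides, and by [lag_inj] only
    types, heights and colours have to be compared.  All of these count
    positions k by the relative order of k and p k, and theta and the Kreweras
    complement become transparent after reindexing by their inverses, except
    at a single position whose contribution is the correction term in the
    definition of xi (where cs is p n) and of vnest (at pone). *)

Require Import Defs.
From mathcomp Require Import all_boot all_order all_fingroup all_algebra.
From mathcomp Require Import zify.

Set Implicit Arguments.
Unset Strict Implicit.
Unset Printing Implicit Defensive.

Import Order.TTheory GRing.Theory Num.Theory.

Local Open Scope ring_scope.

(** Spreads a one-position correction over a sum, so that later identities can be checked term by
    term. *)
Lemma sum_eq_andz n (k : 'I_n) (b : bool) :
  \sum_(j < n) ((j == k) && b)%:Z = b%:Z :> int.
Proof. by rewrite (bigD1 k) //= eqxx big1 ?addr0 // => j /negPf ->. Qed.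

(** * Injectivity of the Foata-Zeilberger map *)

Section FoataZeilberger.
Variable n : nat.
Implicit Types p q : 'S_n.

Lemma FZ_inNE p i : inNE (FZ_word p i) = (i <= (p^-1)%g i)%N.
Proof.
have E := fix_permV p i.
rewrite ffunE /=; case: (ltngtP i (p i)) => h1;
  case: (ltngtP i ((p^-1)%g i)) => h2 //=; lia.
Qed.

Lemma side_permV p i :
  side p ((p^-1)%g i) =
    if (i <= (p^-1)%g i)%N then #|[set j : 'I_n | ((p^-1)%g i < j)%N && (p j < i)%N]|
    else #|[set j : 'I_n | (j < (p^-1)%g i)%N && (i < p j)%N]|.
Proof.
rewrite /side inE permKV; case: leqP => le_i; apply: eq_card => j;
  rewrite !inE; lia.
Qed.

Lemma side_permVz p i :
  (side p ((p^-1)%g i))%:Z =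
    if (i <= (p^-1)%g i)%N then \sum_(j < n) (((p^-1)%g i < j)%N && (p j < i)%N)%:Z
    else \sum_(j < n) ((j < (p^-1)%g i)%N && (i < p j)%N)%:Z.
Proof. by rewrite side_permV -!card_sumz; case: ifP. Qed.

Lemma lcol_Phi_FZ p i :
  lcol (Phi_FZ p) i = (side p ((p^-1)%g i))%:Z + (~~ (i <= (p^-1)%g i)%N)%:Z.
Proof. by rewrite /lcol /= ffunE inSdEE FZ_inNE. Qed.

Section Injectivity.
Variables p q : 'S_n.
Hypothesis eq_Ep : forall i : 'I_n, (i < p i)%N = (i < q i)%N.
Hypothesis eq_EpV : forall i : 'I_n, (i <= (p^-1)%g i)%N = (i <= (q^-1)%g i)%N.
Hypothesis eq_side : forall i : 'I_n, side p ((p^-1)%g i) = side q ((q^-1)%g i).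

(** If [q] placed [i] further right, every position counted for [p] would also be counted for [q],
    and so would the position of [i] in [p], against [eq_side]. *)
Lemma Ep_permV_leq (i : 'I_n) : ((p^-1)%g i < i)%N ->
    (forall v : 'I_n, (v < i)%N -> ((p^-1)%g v < v)%N -> (p^-1)%g v = (q^-1)%g v) ->
  ((q^-1)%g i <= (p^-1)%g i)%N.
Proof.
move=> lt_i IH; rewrite leqNgt; apply/negP => lt_pq.
have := eq_side i; rewrite !side_permV -eq_EpV leqNgt lt_i /= => eq_card.
(* A smaller value [q j] would be an exceedance value, which by [IH] sits at [j] in [p] too. *)
have q_gt (j : 'I_n) : (j <= (p^-1)%g i)%N -> (i <= p j)%N -> (i < q j)%N.
  move=> le_j le_pj; have lt_jp : (j < p j)%N by lia.
  case: (ltngtP (q j) i) => // [lt_qj|/val_inj eq_qj].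
    have := IH (q j) lt_qj; have := eq_Ep j; have := eq_EpV (q j).
    rewrite permK => E1 E2 IHj.
    by have /(canRL (permKV p))/(congr1 val) /= E3 := IHj ltac:(lia); lia.
  by rewrite -eq_qj permK eq_qj in lt_pq; lia.
suff: (#|[set j : 'I_n | (j < (p^-1)%g i)%N && (i < p j)%N]|
       < #|[set j : 'I_n | (j < (q^-1)%g i)%N && (i < q j)%N]|)%N by rewrite eq_card ltnn.
apply: proper_card; apply/properP; split.
  by apply/subsetP => j; rewrite !inE => /andP[? ?]; rewrite q_gt; lia.
by exists ((p^-1)%g i); rewrite !inE ?ltnn // lt_pq q_gt // permKV.
Qed.

Lemma notEp_permV_geq (i : 'I_n) : (i <= (p^-1)%g i)%N ->
    (forall v : 'I_n, (i < v)%N -> (v <= (p^-1)%g v)%N -> (p^-1)%g v = (q^-1)%g v) ->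
  ((p^-1)%g i <= (q^-1)%g i)%N.
Proof.
move=> le_i IH; rewrite leqNgt; apply/negP => lt_qp.
have := eq_side i; rewrite !side_permV -eq_EpV le_i /= => eq_card.
have q_lt (j : 'I_n) : ((p^-1)%g i <= j)%N -> (p j <= i)%N -> (q j < i)%N.
  move=> le_j le_pj; have le_pjj : (p j <= j)%N by lia.
  case: (ltngtP (q j) i) => // [lt_qj|/val_inj eq_qj].
    have := IH (q j) lt_qj; have := eq_Ep j; have := eq_EpV (q j).
    rewrite permK => E1 E2 IHj.
    by have /(canRL (permKV p))/(congr1 val) /= E3 := IHj ltac:(lia); lia.
  by rewrite -eq_qj permK eq_qj in lt_qp; lia.
suff: (#|[set j : 'I_n | ((p^-1)%g i < j)%N && (p j < i)%N]|
       < #|[set j : 'I_n | ((q^-1)%g i < j)%N && (q j < i)%N]|)%N by rewrite eq_card ltnn.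
apply: proper_card; apply/properP; split.
  by apply/subsetP => j; rewrite !inE => /andP[? ?]; rewrite q_lt; lia.
by exists ((p^-1)%g i); rewrite !inE ?ltnn // lt_qp q_lt // permKV.
Qed.

End Injectivity.

Lemma Phi_FZ_inj : injective (@Phi_FZ n).
Proof.
move=> p q eq_Phi.
have eq_word : FZ_word p = FZ_word q by have := congr1 (@lword n) eq_Phi.
have eq_col : FZ_col p = FZ_col q by have := congr1 (@lcol n) eq_Phi.
have eq_EpV (i : 'I_n) : (i <= (p^-1)%g i)%N = (i <= (q^-1)%g i)%N.
  by rewrite -!FZ_inNE eq_word.
(* The letter fixes [delta], the difference of the two indicators, and [eq_EpV] fixes one of
   them. *)
have eq_Ep (i : 'I_n) : (i < p i)%N = (i < q i)%N.
  have := eq_EpV i; have := FZ_deltaE p i; have := FZ_deltaE q i.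
  by rewrite eq_word => ->; lia.
have eq_side i : side p ((p^-1)%g i) = side q ((q^-1)%g i).
  have := congr1 (fun c : {ffun _ -> int} => c i) eq_col.
  by rewrite [FZ_col p i]ffunE [FZ_col q i]ffunE eq_word; lia.
apply: invg_inj; apply/permP => i.
case: (ltnP ((p^-1)%g i) i) => [|].
  have [m] := ubnP i; elim: m i => // m IHm i lt_im lt_i.
  have IH (v : 'I_n) : (v < i)%N -> ((p^-1)%g v < v)%N -> (p^-1)%g v = (q^-1)%g v.
    by move=> lt_vi; apply: IHm; lia.
  (* The one-sided bound is used twice, first with [p] and [q] exchanged. *)
  apply/val_inj/eqP; rewrite eqn_leq; apply/andP; split.
    apply: Ep_permV_leq => //; first by have := eq_EpV i; lia.
    by move=> v lt_vi lt_v; rewrite IH //; have := eq_EpV v; lia.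
  exact: Ep_permV_leq.
have [m] := ubnP (n - i); elim: m i => // m IHm i lt_im le_i.
have IH (v : 'I_n) : (i < v)%N -> (v <= (p^-1)%g v)%N -> (p^-1)%g v = (q^-1)%g v.
  by move=> lt_iv; apply: IHm; have := ltn_ord v; lia.
apply/val_inj/eqP; rewrite eqn_leq; apply/andP; split.
  exact: notEp_permV_geq.
apply: notEp_permV_geq => //; first by rewrite -eq_EpV.
by move=> v lt_iv le_v; rewrite IH // eq_EpV.
Qed.

End FoataZeilberger.

(** * The involution [xi] corresponds to [theta] *)

Section Theta.
Variable n : nat.
Implicit Type p : 'S_n.+1.

(** Where [theta] moves position [k]: the last position stays, the others are reversed among
    themselves. *)
Definition theta_pos (k : 'I_n.+1) : 'I_n.+1 := ord_pred (rev_ord k).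

Lemma theta_pos_inj : injective theta_pos.
Proof. by move=> i j /ord_pred_inj/rev_ord_inj. Qed.

Lemma theta_posE k : theta_pos k = (if k == n :> nat then n else n - k.+1)%N :> nat.
Proof.
rewrite /theta_pos /= subSS; have := ltn_ord k; case: eqP => [-> _|nk lkn].
  by rewrite subnn modn_small.
have -> : (n - k + n.+1).-1 = (n - k.+1 + n.+1)%N by lia.
by rewrite modnDr modn_small //; lia.
Qed.

Lemma thetaE p i : theta p i = rev_ord (p (rev_ord (ordS i))).
Proof.
rewrite permE /theta_fun; case: eqP => // i_max; congr (rev_ord (p _)).
by apply: val_inj; rewrite /= [X in (X %% _)%N]i_max modnn; case: i_max => ->; lia.
Qed.

Lemma theta_theta_pos p k : theta p (theta_pos k) = rev_ord (p k).
Proof. by rewrite thetaE /theta_pos ord_predK rev_ordK. Qed.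

Lemma thetaV p i : ((theta p)^-1)%g i = theta_pos ((p^-1)%g (rev_ord i)).
Proof.
by apply: (@perm_inj _ (theta p)); rewrite permKV theta_theta_pos permKV rev_ordK.
Qed.

(** The reversals in [theta] cancel those in [rci], leaving the inverse after a cyclic shift. *)
Lemma theta_rci p : theta (rci p) = kreweras p.
Proof. by apply/permP => i; rewrite thetaE !permE !rev_ordK. Qed.

(** No position follows the last one, so its value has colour 0. A larger value is either an
    exceedance value, with colour at least 1, or has the last position in its side count. *)
Lemma cs_Phi_FZ p : cs (Phi_FZ p) = (p ord_max).+1.
Proof.
apply: csE => [|i lt_i]; rewrite lcol_Phi_FZ side_permVz.
  rewrite permK -ltnS ltn_ord /= big1 // => j _.
  by rewrite ltnNge -ltnS ltn_ord.
case: leqP => le_i /=; last first.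
  by rewrite -card_sumz; lia.
rewrite addr0 -card_sumz eqz_nat -lt0n; apply/card_gt0P; exists ord_max.
rewrite inE lt_i andbT ltn_neqAle -ltnS ltn_ord andbT.
by apply/eqP => /val_inj E; move: lt_i; rewrite -E permKV ltnn.
Qed.

Lemma xi_Phi_FZ p : xi (Phi_FZ p) = Phi_FZ (theta p).
Proof.
(* Uniqueness identifies [xi] with the explicit construction. *)
have -> : xi (Phi_FZ p) = xi_fun (Phi_FZ p).
  by rewrite (s2valP' (xi_exists_unique n) _ (@xi_fun_is_xi n)).
have shiftE i : xi_shift (Phi_FZ p) i =
    ((i < p ord_max)%N && (i <= (p^-1)%g i)%N)%:Z
    - ((p ord_max < i)%N && ((p^-1)%g i < i)%N)%:Z.
  by rewrite /xi_shift cs_Phi_FZ /lword /= inSdEE FZ_inNE -ltnNge !ltnS.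
have last_pos (i : 'I_n.+1) : ((p^-1)%g i == n :> nat) = (i == p ord_max :> nat).
  by rewrite -[n]/(val (@ord_max n)) !val_eqE (can2_eq (permKV p) (permK p)).
have le_n (k : 'I_n.+1) : (k <= n)%N by rewrite -ltnS.
have lt_n (k : 'I_n.+1) : k != ord_max -> (k < n)%N.
  by move=> nk; rewrite ltn_neqAle le_n andbT.
apply: lag_inj => j.
- rewrite xi_fun_up /xi_up cs_Phi_FZ inSdEE /lword /= !FZ_inNE thetaV theta_posE.
  rewrite last_pos; set i := rev_ord j; have := le_n j; have := le_n ((p^-1)%g i).
  have := last_pos i; rewrite {}/i /= => ? ? ?; case: ifP; lia.
- rewrite xi_fun_height shiftE /lheight /= !ffunE !FZ_heightE card_cross !card_sumz.
  set i := rev_ord j; set k0 := (p^-1)%g i.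
  have iE : (i + j = n :> nat)%N by rewrite /= subSS subnK.
  rewrite [RHS](reindex_inj theta_pos_inj).
  (* After reindexing, the two counts differ only at [k0], where [p k < i] becomes [p k <= i], and
     at the last position, which is never counted for [theta p]. *)
  have -> : ((i < p ord_max)%N && (i <= k0)%N)%:Z
      - ((p ord_max < i)%N && (k0 < i)%N)%:Z
    = \sum_(k < n.+1) (((k == k0) && ((i <= k0)%N && (k0 != n :> nat)))%:Z
                    - ((k == ord_max) && (p ord_max < i)%N)%:Z).
    rewrite sumrB !sum_eq_andz last_pos.
    by case: (ltngtP i (p ord_max)); case: leqP => //=; lia.
  clearbody i; rewrite -big_split; apply: eq_bigr => k _.
  have -> : (k == k0) = (p k == i :> nat).
    by rewrite val_eqE (can2_eq (permK p) (permKV p)).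
  rewrite theta_theta_pos theta_posE [in LHS]/=.
  have := le_n k; have := le_n (p k); have := le_n i; have := last_pos i.
  have [->|/[dup] /lt_n lt_kn nk] := eqVneq k ord_max.
    by rewrite eqxx /= -/k0; lia.
  have k0E : p k == i :> nat -> k = k0 :> nat.
    by rewrite /k0 => /eqP/val_inj <-; rewrite permK.
  by rewrite (ltn_eqF lt_kn) //= -/k0; lia.
- rewrite xi_fun_col shiftE !lcol_Phi_FZ !side_permVz thetaV.
  set i := rev_ord j; set k0 := (p^-1)%g i.
  have iE : (i + j = n :> nat)%N by rewrite /= subSS subnK.
  have := le_n k0; have := le_n i; have := last_pos i.
  clearbody i; rewrite -/k0.
  have [k0n|k0n] := eqVneq k0 ord_max.
    rewrite theta_posE k0n eqxx => /esym/eqP i_last -> _.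
    rewrite le_n /= !big1 ?i_last ?ltnn //= => l _; first by rewrite ltnNge le_n.
    by rewrite ltnNge le_n.
  have lt_k0n := lt_n k0 k0n; have {}k0n := ltn_eqF lt_k0n.
  (* Reversal exchanges the two kinds of side count; the last position, which stays last, yields the
     correction. *)
  have sumS : \sum_(l < n.+1) ((theta_pos k0 < l)%N && (theta p l < j)%N)%:Z
      = \sum_(l < n.+1) ((l < k0)%N && (i < p l)%N)%:Z + (i < p ord_max)%N%:Z.
    rewrite (reindex_inj theta_pos_inj) -(@sum_eq_andz n.+1 ord_max (i < p ord_max)%N) -big_split.
    apply: eq_bigr => l _; rewrite theta_theta_pos !theta_posE k0n -val_eqE /=.
    have := le_n l; have := le_n (p l); case: eqP => [ln|nl]; last by lia.
    have -> : l = ord_max by apply: val_inj.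
    by rewrite /=; lia.
  have sumE : \sum_(l < n.+1) ((l < theta_pos k0)%N && (j < theta p l)%N)%:Z
      = \sum_(l < n.+1) ((k0 < l)%N && (p l < i)%N)%:Z - (p ord_max < i)%N%:Z.
    rewrite (reindex_inj theta_pos_inj) -(@sum_eq_andz n.+1 ord_max (p ord_max < i)%N) -sumrB.
    apply: eq_bigr => l _; rewrite theta_theta_pos !theta_posE k0n -val_eqE /=.
    have := le_n l; have := le_n (p l); case: eqP => [ln|nl]; last by lia.
    have -> : l = ord_max by apply: val_inj.
    by rewrite /=; lia.
  rewrite sumS sumE theta_posE k0n => lastE le_in _.
  have -> : (j <= n - k0.+1)%N = ~~ (i <= k0)%N by lia.
  by case: (leqP i k0) => le_i /=; case: ltngtP lastE => //=; lia.
Qed.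

End Theta.

(** * The second bijection and the Kreweras complement *)

Section Kreweras.
Variable n : nat.
Implicit Type p : 'S_n.+1.

Lemma kreweras_invK p : cancel (kreweras_inv p) (kreweras p).
Proof. by move=> i; rewrite permE ord_predK permK. Qed.

Lemma krewerasV p i : ((kreweras p)^-1)%g i = kreweras_inv p i.
Proof. by rewrite -{1}[i](kreweras_invK p) permK. Qed.

(** At [pone p] the cyclic predecessor of the value 0 wraps to [n], so the inequality always holds
    there; elsewhere it means [i < p i]. *)
Lemma YZL_inNE p i : inNE (YZL_word p i) = (i <= kreweras_inv p i)%N.
Proof.
rewrite kreweras_invE ffunE /=; have [->|_] := eqVneq i ord_max.
  rewrite [pone p == _]eq_sym; have [_|] := eqVneq ord_max (pone p).
    by rewrite leqnn.
  rewrite pone0 => p_max; have := ltn_ord (p ord_max) => lt_p.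
  by have -> : (@ord_max n <= (p ord_max).-1)%N = false by move=> /=; lia.
have [_|] := eqVneq i (pone p); first by rewrite [RHS]leq_ord; case: ifP.
rewrite pone0 => pi0; have -> : (i <= (p i).-1)%N = (i < p i)%N by lia.
by case: (i < p i)%N; case: (_ <= _)%N.
Qed.

Lemma nestE p i :
  (nest p i)%:Z = if (i < p i)%N then \sum_(j < n.+1) ((j < i)%N && (p i < p j)%N)%:Z
                  else \sum_(j < n.+1) ((p j < p i)%N && (i < j)%N)%:Z.
Proof.
rewrite /nest card_sumz; case: ltnP => le_i; apply: eq_bigr => j _; congr (_%:Z);
  lia.
Qed.

Lemma Phi_YZL_kreweras p : Phi_YZL p = Phi_FZ (kreweras p).
Proof.
apply: lag_inj => i; rewrite /lword /lheight /lcol /=.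
- by rewrite YZL_inNE FZ_inNE krewerasV.
- rewrite !ffunE; apply: heightP => [|j|]; [exact: height0| | exact: ltnW].
  by rewrite heightS FZ_deltaE YZL_deltaE krewerasV; lia.
- rewrite [YZL_col _ _]ffunE [FZ_col _ _]ffunE !inSdEE YZL_inNE FZ_inNE.
  rewrite side_permVz krewerasV; congr (_ + _).
  have kK := can_inj (kreweras_invK p).
  have p0 : p (pone p) = 0%N :> nat by apply/eqP; rewrite -pone0.
  have kE := kreweras_invE p; rewrite /vnest nestE.
  have [ip|] := eqVneq i (pone p).
    rewrite kE ip eqxx p0 ltnn /= leq_ord !big1 // => j _.
    by rewrite ltnNge leq_ord.
  move=> ip; have qiE : kreweras_inv p i = (p i).-1 :> nat by rewrite kE (negPf ip).
  move: ip; rewrite pone0 => pi0.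
  (* Lowering both values by 1 keeps their order, except that [pone p] goes from the least value to
     the greatest; this is the correction in [vnest]. *)
  have sumE : \sum_(j < n.+1) ((kreweras_inv p i < j)%N && (kreweras p j < i)%N)%:Z
      = \sum_(j < n.+1) ((j < i)%N && (p i < p j)%N)%:Z + (pone p < i)%N%:Z.
    rewrite (reindex_inj kK) -(@sum_eq_andz n.+1 (pone p) (pone p < i)%N) -big_split.
    apply: eq_bigr => j _; rewrite kreweras_invK qiE kE.
    have := ltn_ord (p i); have [->|] := eqVneq j (pone p); first by rewrite p0 /=; lia.
    by rewrite pone0 /=; lia.
  have sumS : \sum_(j < n.+1) ((j < kreweras_inv p i)%N && (i < kreweras p j)%N)%:Z
      = \sum_(j < n.+1) ((p j < p i)%N && (i < j)%N)%:Z - (i < pone p)%N%:Z.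
    rewrite (reindex_inj kK) -(@sum_eq_andz n.+1 (pone p) (i < pone p)%N) -sumrB.
    apply: eq_bigr => j _; rewrite kreweras_invK qiE kE.
    have := ltn_ord (p i); have [->|] := eqVneq j (pone p); first by rewrite p0 /=; lia.
    by rewrite pone0 /=; lia.
  rewrite sumE sumS qiE; have -> : (i <= (p i).-1)%N = (i < p i)%N by lia.
  by case: (ltnP i (p i)) => _ /=; case: ifP; lia.
Qed.

End Kreweras.

Theorem theorem4p24 (n : nat) (pi : 'S_n.+1) :
  Phi_FZ_inv (xi (Phi_FZ pi)) = Some (theta pi) /\
  Phi_YZL pi = Phi_FZ (theta (rci pi)) /\
  Phi_FZ (theta (rci pi)) = Phi_FZ (kreweras pi).
Proof.
rewrite theta_rci xi_Phi_FZ Phi_YZL_kreweras; split=> //.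
(* Injectivity forces the picked preimage to be [theta pi], which itself excludes [None]. *)
rewrite /Phi_FZ_inv; case: pickP => [p /eqP /Phi_FZ_inj -> //|/(_ (theta pi))].
by rewrite eqxx.
Qed.
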